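(* Define the following matrices (which give the action on $V$ of the generators $x_{ij}$ of the $q$-tetrahedron algebra $\boxtimes_q$): $x_{01}=A\Phi\Psi^{-1}$, $x_{12}=B\Phi^{-1}$, $x_{23}=A^*\Phi\Psi$, $x_{30}=B^*\Phi^{-1}$, $x_{02}=K\Psi^{-1}$, $x_{20}=\Psi K^{-1}$, $x_{13}=K^*\Psi$, $x_{31}=\Psi^{-1}(K^* )^{-1}$. Then $x_{01}^t=x_{01}$, $x_{12}^t=x_{30}$, $x_{23}^t=x_{23}$, $x_{30}^t=x_{12}$, $x_{02}^t=x_{31}$, $x_{20}^t=x_{13}$, $x_{13}^t=x_{20}$, $x_{31}^t=x_{02}$.
   Context: Let $\Gamma=(X,R)$ be a finite, undirected, connected, distance-regular graph without loops or multiple edges, with path-length distance $\partial$, diameter $D\ge3$, intersection numbers $c_i,b_i$. Fix $b,\beta\in\mathbb C$ with $b\ne1$ and assume $\Gamma$ has classical parameters $(D,b,\alpha,\beta)$ with $\alpha=b-1$, i.e. $c_i=b^{i-1}\frac{b^i-1}{b-1}$, $b_i=(\beta+1-b^i)\frac{b^D-b^i}{b-1}$ ($0\le i\le D$). Fix $q\in\mathbb C$ with $q^2=b$. Let $E_0,\dots,E_D$ be the primitive idempotents of the Bose–Mesner algebra ordered so that Krein parameters equal intersection numbers; $\Gamma$ is $Q$-polynomial for this ordering. Let $V=\mathbb C X$ with Hermitian form $\langle u,v\rangle=u^t\overline v$. Fix a vertex $x$; $E^*_i$ is the diagonal matrix with $(y,y)$-entry $1$ if $\partial(x,y)=i$,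 else $0$. For $-1\le i,j\le D$: $V^{\downarrow\downarrow}_{i,j}=(E^*_0V+\dots+E^*_iV)\cap(E_0V+\dots+E_jV)$, $V^{\uparrow\downarrow}_{i,j}=(E^*_DV+\dots+E^*_{D-i}V)\cap(E_0V+\dots+E_jV)$, $V^{\downarrow\uparrow}_{i,j}=(E^*_0V+\dots+E^*_iV)\cap(E_DV+\dots+E_{D-j}V)$, $V^{\uparrow\uparrow}_{i,j}=(E^*_DV+\dots+E^*_{D-i}V)\cap(E_DV+\dots+E_{D-j}V)$ (zero if $i=-1$ or $j=-1$). For $0\le i,j\le D$, $\tilde V^{\mu\nu}_{i,j}$ is the orthogonal complement of $V^{\mu\nu}_{i-1,j}+V^{\mu\nu}_{i,j-1}$ in $V^{\mu\nu}_{i,j}$; for each $\mu,\nu$, $V=\bigoplus_{i,j}\tilde V^{\mu\nu}_{i,j}$. Define $A=\sum_{i=0}^Dq^{D-2i}E_i$, $A^*=\sum_{i=0}^Dq^{D-2i}E^*_i$, and $B,B^*,K,K^*,\Phi,\Psi$ as the unique matrices such that for all $0\le i,j\le D$: $B=q^{i-j}I$ on $\tilde V^{\downarrow\uparrow}_{i,j}$; $B^*=q^{j-i}I$ on $\tilde V^{\uparrow\downarrow}_{i,j}$; $K=q^{i-j}I$ on $\tilde V^{\downarrow\downarrow}_{i,j}$; $K^*=q^{i-j}I$ on $\tilde V^{\uparrow\uparrow}_{i,j}$; $\Phi=q^{i+j-D}I$ on $\tilde V^{\downarrow\downarrow}_{i,j}$; $\Psi=q^{i+j-D}I$ on $\tilde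 V^{\downarrow\uparrow}_{i,j}$. (It is known that these matrices lie in the subalgebra $T$ of $\mathrm{Mat}_X(\mathbb C)$ generated by the Bose–Mesner algebra and $E^*_0,\dots,E^*_D$, that $\Phi,\Psi$ are central in $T$, and that the matrices $x_{ij}$ above define a module structure on $V$ for the $q$-tetrahedron algebra $\boxtimes_q$.) *)

(* Defs.v *)
From HB Require Import structures.
From mathcomp Require Import all_boot all_order all_algebra.
From mathcomp Require Export complex.
From mathcomp Require Export reals.

Set Implicit Arguments.
Unset Strict Implicit.
Unset Printing Implicit Defensive.

Import Order.TTheory GRing.Theory Num.Theory.
Local Open Scope ring_scope.

Definition walk_of_length (X : finType) (e : rel X) (x y : X) (k : nat) : bool :=
  [exists p : k.-tuple X, path e x p && (last x p == y)].

(* A shortest walk has fewer than #|X| edges, so in a connected graph the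
   search over [iota 0 #|X|] always succeeds. *)
Definition dist (X : finType) (e : rel X) (x y : X) : nat :=
  find (walk_of_length e x y) (iota 0 #|X|).

Definition diameter (X : finType) (e : rel X) : nat :=
  (\max_(x : X) \max_(y : X) dist e x y)%N.

Definition simple_graph (X : finType) (e : rel X) : Prop :=
  symmetric e /\ irreflexive e.

Definition connected_graph (X : finType) (e : rel X) : Prop :=
  forall x y : X, connect e x y.

(* [p h i j] is the intersection number $p^h_{ij}$. *)
Definition distance_regular (X : finType) (e : rel X)
    (p : nat -> nat -> nat -> nat) : Prop :=
  forall (x y : X) (i j : nat),
    #|[set z | (dist e x z == i) && (dist e z y == j)]| = p (dist e x y) i j.

(* $c_i = p^i_{1,i-1}$ and $b_i = p^i_{1,i+1}$.  The values $c_0 = 0$ and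
   $b_D = 0$ are automatic: no neighbour of [x] is at distance [0.-1 = 0] from
   [x], and no vertex is at distance $D+1$ from another. *)
Definition c_num (p : nat -> nat -> nat -> nat) (i : nat) : nat := p i 1 i.-1.
Definition b_num (p : nat -> nat -> nat -> nat) (i : nat) : nat := p i 1 i.+1.

(* Classical parameters $(D, b, \alpha, \beta)$ with $\alpha = b - 1$. *)
Definition classical_parameters_alpha_eq_bm1 (C : fieldType)
    (p : nat -> nat -> nat -> nat) (D : nat) (b beta : C) : Prop :=
  forall i : nat, (i <= D)%N ->
    (c_num p i)%:R = b ^ (i%:Z - 1) * ((b ^+ i - 1) / (b - 1)) /\
    (b_num p i)%:R = (beta + 1 - b ^+ i) * ((b ^+ D - b ^+ i) / (b - 1)).

(* Matrices in $Mat_X(C)$ are indexed by 'I_#|X|, the index [s] standing for the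
   vertex [enum_val s]; elements of $V = C X$ are column vectors. *)
Definition distance_matrix (C : fieldType) (X : finType) (e : rel X) (i : nat) :
    'M[C]_#|X| :=
  \matrix_(s, t) (dist e (enum_val s) (enum_val t) == i)%:R.

Definition Bose_Mesner (C : fieldType) (X : finType) (e : rel X) (D : nat) :
    {vspace 'M[C]_#|X|} :=
  <<[seq distance_matrix C e i | i <- iota 0 D.+1]>>%VS.

(* The basis of the Bose-Mesner algebra made of mutually orthogonal idempotents
   summing to the identity; it is unique up to order. *)
Definition primitive_idempotents (C : fieldType) (X : finType) (e : rel X)
    (D : nat) (E : 'I_D.+1 -> 'M[C]_#|X|) : Prop :=
  [/\ basis_of (Bose_Mesner C e D) (codom E),
      forall i j, E i *m E j = if i == j then E i else 0
    & \sum_i E i = 1%:M].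

(* [k h i j] is the Krein parameter $q^h_{ij}$: the entrywise product of
   $E_i$ and $E_j$ is $|X|^{-1} \sum_h q^h_{ij} E_h$. *)
Definition Krein_parameters (C : fieldType) (X : finType) (D : nat)
    (E : 'I_D.+1 -> 'M[C]_#|X|) (k : 'I_D.+1 -> 'I_D.+1 -> 'I_D.+1 -> C) : Prop :=
  forall i j,
    map2_mx *%R (E i) (E j) = #|X|%:R^-1 *: \sum_h k h i j *: E h.

Definition dual_idempotent (C : fieldType) (X : finType) (e : rel X) (x : X)
    (D : nat) (i : 'I_D.+1) : 'M[C]_#|X| :=
  diag_mx (\row_s (dist e x (enum_val s) == i)%:R).

(* The subspace $M V$ of $V$. *)
Definition col_space (C : fieldType) (n : nat) (M : 'M[C]_n) :
    {vspace 'cV[C]_n} :=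
  limg (linfun (mulmx M : 'cV[C]_n -> 'cV[C]_n)).

Definition herm (C : numClosedFieldType) (n : nat) (u v : 'cV[C]_n) : C :=
  (u^T *m map_mx Num.conj v) 0 0.

Inductive arrow := down | up.

(* $F_0V + ... + F_iV$ for [down] and $F_DV + ... + F_{D-i}V$ for [up]; the sum
   is empty when $i = -1$. *)
Definition arrow_sum (C : fieldType) (n D : nat) (m : arrow)
    (F : 'I_D.+1 -> 'M[C]_n) (i : int) : {vspace 'cV[C]_n} :=
  match m with
  | down => (\sum_(h < D.+1 | (h%:Z <= i)%R) col_space (F h))%VS
  | up => (\sum_(h < D.+1 | (D%:Z - i <= h%:Z)%R) col_space (F h))%VS
  end.

(* $V^{\mu\nu}_{i,j}$, for the dual idempotents [Es] and the idempotents [E]. *)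
Definition split_space (C : fieldType) (n D : nat) (Es E : 'I_D.+1 -> 'M[C]_n)
    (mu nu : arrow) (i j : int) : {vspace 'cV[C]_n} :=
  (arrow_sum mu Es i :&: arrow_sum nu E j)%VS.

(* Membership in $\tilde V^{\mu\nu}_{i,j}$. *)
Definition in_split_tilde (C : numClosedFieldType) (n D : nat)
    (Es E : 'I_D.+1 -> 'M[C]_n) (mu nu : arrow) (i j : int) (v : 'cV[C]_n) : Prop :=
  v \in split_space Es E mu nu i j /\
  forall u : 'cV[C]_n,
    u \in (split_space Es E mu nu (i - 1)%R j + split_space Es E mu nu i (j - 1)%R)%VS ->
    herm v u = 0.

(* The $\tilde V^{\mu\nu}_{i,j}$ span $V$, so at most one matrix [M]
   satisfies this. *)
Definition acts_on_split (C : numClosedFieldType) (n D : nat)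
    (Es E : 'I_D.+1 -> 'M[C]_n) (mu nu : arrow) (lambda : int -> int -> C)
    (M : 'M[C]_n) : Prop :=
  forall (i j : 'I_D.+1) (v : 'cV[C]_n),
    in_split_tilde Es E mu nu i%:Z j%:Z v -> M *m v = lambda i%:Z j%:Z *: v.

(* Main.v *)
Require Import Defs.
From HB Require Import structures.
From mathcomp Require Import all_boot all_order all_algebra.
From mathcomp Require Import complex reals zify ring.

(* Let [F_i], [G_j] be the dual and the primitive idempotents, $F_{\le i}$ and
   $G_{\le j}$ the flags they generate, and $N_r$ the sum of the
   $F_{\le i}V \cap G_{\le j}V$ with $i + j < r$.  Raising and lowering with the adjacency
   and the dual adjacency matrix show that $N_r$ is a $T$-module, so
   $M_r = N_{r+1} \cap N_r^\perp$ is one too, and the pieces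
   $F_{\le i}V \cap G_{\le j}V \cap M_{i+j}$, which lie in the split spaces, already
   span $V$: no decomposition into irreducible $T$-modules is needed.  Reversing both
   orderings, the modular law gives $M^{\uparrow\uparrow}_s \subseteq
   N^{\downarrow\downarrow}_{2D-s+1}$, whence the pieces of type $\mu\nu$ and of the
   opposite type are orthogonal unless their indices add up to $(D, D)$.  All
   idempotents being real, comparing bilinear forms on these pieces gives $B^t = B^*$ and
   $K^t K^* = I$; moreover $\Phi$ and $\Psi$ are scalar on each $M_r$, hence symmetric and
   central. *)

Set Implicit Arguments.
Unset Strict Implicit.
Unset Printing Implicit Defensive.

Import Order.TTheory GRing.Theory Num.Theory.
Local Open Scope ring_scope.

Local Notation cmx M := (map_mx Num.conj M).

(** * Orthogonal complements *)

Section Hermitian.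
Variables (C : numClosedFieldType) (n : nat).
Implicit Types (u v w : 'cV[C]_n) (U : {vspace 'cV[C]_n}) (M : 'M[C]_n).

Lemma cmxK m k (M : 'M[C]_(m, k)) : cmx (cmx M) = M.
Proof. by apply/matrixP=> i j; rewrite !mxE conjCK. Qed.

Lemma hermDl u v w : herm (u + v) w = herm u w + herm v w.
Proof. by rewrite /herm linearD mulmxDl mxE. Qed.

Lemma herm0l w : herm 0 w = 0.
Proof. by rewrite /herm linear0 mul0mx mxE. Qed.

Lemma hermC u v : herm u v = (herm v u)^*.
Proof.
rewrite /herm !mxE rmorph_sum; apply: eq_bigr => i _.
by rewrite !mxE rmorphM /= conjCK mulrC.
Qed.

Lemma herm0r u : herm u 0 = 0.
Proof. by rewrite hermC herm0l rmorph0. Qed.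

Lemma hermDr u v w : herm u (v + w) = herm u v + herm u w.
Proof. by rewrite hermC hermDl rmorphD /= -!hermC. Qed.

Lemma herm_sumr I (r : seq I) P (f : I -> 'cV[C]_n) u :
  herm u (\sum_(i <- r | P i) f i) = \sum_(i <- r | P i) herm u (f i).
Proof. by apply: (big_morph (herm u) (hermDr u) (herm0r u)). Qed.

Lemma herm_conj u v : herm (cmx u) (cmx v) = (herm u v)^*.
Proof. by rewrite /herm map_trmx -map_mxM mxE. Qed.

Lemma herm_conjr u v : herm u (cmx v) = (u^T *m v) 0 0.
Proof. by rewrite /herm cmxK. Qed.

Lemma herm_mulmx M u v : herm (M *m u) v = herm u ((cmx M)^T *m v).
Proof. by rewrite /herm trmx_mul map_mxM -mulmxA -map_trmx cmxK. Qed.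

Lemma herm_definite v : herm v v = 0 -> v = 0.
Proof.
rewrite /herm mxE => h; apply/colP=> i; rewrite !mxE.
have := psumr_eq0P (P := predT) (F := fun j => v^T 0 j * cmx v j 0).
move=> /(_ _ h i isT); rewrite !mxE => hi; apply/eqP.
rewrite -normr_eq0 -sqrf_eq0 normCK hi.
  by [].
by move=> j _; rewrite !mxE mul_conjC_ge0.
Qed.

(** The rows of the matrix are the conjugate transposes of a basis of [U]. As a kernel, the
    complement has dimension at least [n - \dim U] by rank-nullity. *)
Definition orth U : {vspace 'cV[C]_n} :=
  lker (linfun (mulmx (\matrix_(k < \dim U) (cmx (vbasis U)`_k)^T)
          : 'cV[C]_n -> 'cV[C]_(\dim U))).

Lemma orthP U v : reflect (forall u, u \in U -> herm v u = 0) (v \in orth U).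
Proof.
have E k : (linfun (mulmx (\matrix_(k < \dim U) (cmx (vbasis U)`_k)^T)
          : 'cV[C]_n -> 'cV[C]_(\dim U)) v) k 0 = herm v (vbasis U)`_k.
  by rewrite lfunE /= /herm !mxE; apply: eq_bigr => i _; rewrite !mxE mulrC.
rewrite memv_ker; apply: (iffP eqP) => [h u /coord_vbasis-> | h].
  rewrite herm_sumr big1 // => k _.
  rewrite hermC /herm linearZ /= -scalemxAl mxE.
  by rewrite -/(herm _ v) hermC -E h mxE rmorph0 mulr0 rmorph0.
by apply/colP=> k; rewrite E h ?mxE // vbasis_mem // mem_nth // size_tuple.
Qed.

Lemma orth_decomposition U v : exists2 u, u \in U & v - u \in orth U.
Proof.
have dis : (U :&: orth U = 0)%VS.
  apply/eqP; rewrite -subv0; apply/subvP=> u /memv_capP[uU /orthP/(_ u uU)].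
  by move/herm_definite->; rewrite mem0v.
have full : (U + orth U)%VS = fullv.
  apply/eqP; rewrite eqEdim subvf /= dimv_disjoint_sum //.
  rewrite -(limg_ker_dim (linfun (mulmx (\matrix_(k < \dim U) (cmx (vbasis U)`_k)^T)
          : 'cV[C]_n -> 'cV[C]_(\dim U))) fullv) capfv -/(orth U) addnC leq_add2r.
  apply: leq_trans (dimvS (subvf _)) _.
  by rewrite dimvf /dim /= muln1.
have : v \in (U + orth U)%VS by rewrite full memvf.
by case/memv_addP=> u uU [w wU ->]; exists u; rewrite // addrC addKr.
Qed.

Lemma orth_self_eq0 U v : v \in U -> v \in orth U -> v = 0.
Proof. by move=> vU /orthP/(_ v vU)/herm_definite. Qed.

Lemma orth_trivial_sub U W : (U <= W)%VS ->
  (forall w, w \in W -> w \in orth U -> w = 0) -> (W <= U)%VS.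
Proof.
move=> UW h; apply/subvP=> w wW; have [u uU wu] := orth_decomposition U w.
by rewrite -[w](subrK u) (h _ _ wu) ?add0r // memvB // (subvP UW).
Qed.

Lemma orth_invariant M U :
  (forall v, v \in U -> (cmx M)^T *m v \in U) ->
  forall v, v \in orth U -> M *m v \in orth U.
Proof.
by move=> h v /orthP vU; apply/orthP=> u uU; rewrite herm_mulmx vU // h.
Qed.

End Hermitian.

(** * Split decompositions *)

Section SplitSystem.
Variables (C : numClosedFieldType) (n D : nat).
Implicit Types (F G : 'I_D.+1 -> 'M[C]_n) (u v w : 'cV[C]_n).
Implicit Types (U : {vspace 'cV[C]_n}).

Definition preserves (M : 'M[C]_n) U := forall v, v \in U -> M *m v \in U.

(** Symmetric real idempotents are Hermitian projections, and their flags are closed under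
    conjugation, so that Hermitian orthogonality can be read as vanishing of $u^tv$. *)
Record real_resolution F : Prop := RealResolution {
  res_mul : forall i j, F i *m F j = if i == j then F i else 0;
  res_sum : \sum_i F i = 1%:M;
  res_tr : forall i, (F i)^T = F i;
  res_conj : forall i, cmx (F i) = F i }.

(* [A] plays the role of the adjacency matrix when [F] are the dual
   idempotents, and of the dual adjacency matrix when [F] are the primitive
   ones. *)
Definition tridiagonal_generator F G : Prop := exists (A : 'M[C]_n) (th : 'I_D.+1 -> C),
  [/\ A = \sum_i th i *: G i,
      forall i j : 'I_D.+1, (i.+1 < j)%N || (j.+1 < i)%N -> F i *m A *m F j = 0
    & forall U, preserves A U -> forall i, preserves (G i) U].

(** All that the linear algebra uses of the graph. The conditions are symmetric in [F] and [G] and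
    survive reversing either ordering, so the case $\downarrow\downarrow$ covers all four arrow
    pairs. *)
Record split_system F G : Prop := SplitSystem {
  sys_resl : real_resolution F;
  sys_resr : real_resolution G;
  sys_genl : tridiagonal_generator F G;
  sys_genr : tridiagonal_generator G F }.

Definition flip F := F \o @rev_ord D.+1.

Lemma sum_flip (V : nmodType) (f : 'I_D.+1 -> V) : \sum_i f (rev_ord i) = \sum_i f i.
Proof. by rewrite [RHS](reindex_inj rev_ord_inj). Qed.

Lemma real_resolution_flip F : real_resolution F -> real_resolution (flip F).
Proof.
case=> hm hs ht hc; split=> [i j||i|i] /=; rewrite ?ht ?hc //.
  by rewrite /flip /= hm (inj_eq rev_ord_inj).
by rewrite -hs (sum_flip F).
Qed.

Lemma tridiagonal_generator_flipl F G :
  tridiagonal_generator F G -> tridiagonal_generator (flip F) G.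
Proof.
case=> A [th [hA h3 hg]]; exists A, th; split=> // i j ij; apply: h3.
by have := ltn_ord i; have := ltn_ord j; move: ij => /=; lia.
Qed.

Lemma tridiagonal_generator_flipr F G :
  tridiagonal_generator F G -> tridiagonal_generator F (flip G).
Proof.
case=> A [th [hA h3 hg]]; exists A, (fun i => th (rev_ord i)); split=> //.
  by rewrite hA -(sum_flip (fun i => th i *: G i)).
by move=> U /hg h i; apply: h.
Qed.

Lemma split_system_sym F G : split_system F G -> split_system G F.
Proof. by case. Qed.

Lemma split_system_flipl F G : split_system F G -> split_system (flip F) G.
Proof.
case=> *; split=> //; first exact: real_resolution_flip.
  exact: tridiagonal_generator_flipl.
exact: tridiagonal_generator_flipr.
Qed.

Lemma split_system_flipr F G : split_system F G -> split_system F (flip G).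
Proof. by move=> /split_system_sym/split_system_flipl/split_system_sym. Qed.

(** * Flags generated by a resolution *)

(** This is $F_0V+\dots+F_{i-1}V$, written as a common kernel so that membership is a family of
    equations. With the shift by one, [low F 0] is the zero space of index $-1$. *)
Definition low F (i : nat) : {vspace 'cV[C]_n} :=
  (\bigcap_(h < D.+1 | (i <= h)%N) lker (linfun (mulmx (F h) : 'cV[C]_n -> 'cV[C]_n)))%VS.

Lemma lowP F i v :
  reflect (forall h : 'I_D.+1, (i <= h)%N -> F h *m v = 0) (v \in low F i).
Proof.
rewrite memvE; apply: (iffP subv_bigcapP) => h k ik; have := h k ik.
  by rewrite -memvE memv_ker lfunE => /eqP.
by move=> kv; rewrite -memvE memv_ker lfunE /= kv.
Qed.

Lemma low0 F v : real_resolution F -> v \in low F 0 -> v = 0.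
Proof.
move=> hF /lowP h; rewrite -[v]mul1mx -(res_sum hF) mulmx_suml.
by apply: big1 => i _; apply: h.
Qed.

Lemma low_ge F i v : (D < i)%N -> v \in low F i.
Proof. by move=> Di; apply/lowP=> h ih; have := ltn_ord h; lia. Qed.

Lemma low_mono F i j v : (i <= j)%N -> v \in low F i -> v \in low F j.
Proof. by move=> ij /lowP h; apply/lowP=> k jk; apply: h; lia. Qed.

Lemma resolution_expand F v : real_resolution F -> v = \sum_h F h *m v.
Proof. by move=> hF; rewrite -mulmx_suml (res_sum hF) mul1mx. Qed.

Lemma resolution_herm F h u v : real_resolution F ->
  herm (F h *m u) v = herm u (F h *m v).
Proof. by move=> hF; rewrite herm_mulmx (res_conj hF) (res_tr hF). Qed.

Lemma low_invariant F i Z : (forall h, F h *m Z = Z *m F h) -> preserves Z (low F i).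
Proof.
move=> hZ v /lowP h; apply/lowP=> k ik.
by rewrite mulmxA hZ -mulmxA h // mulmx0.
Qed.

Lemma low_conj F i v : real_resolution F -> v \in low F i -> cmx v \in low F i.
Proof.
move=> hF /lowP h; apply/lowP=> k ik.
by rewrite -(res_conj hF) -map_mxM h // map_mx0.
Qed.

(** Tridiagonality lets [A] raise the [F]-index by at most one, and subtracting the eigenvalue of
    [A] on $G_jV$ removes the top [G]-component. *)
Lemma raising F G A th i (j : nat) v :
  real_resolution F -> real_resolution G -> A = \sum_i th i *: G i ->
  (forall k l : 'I_D.+1, (k.+1 < l)%N || (l.+1 < k)%N -> F k *m A *m F l = 0) ->
  v \in low F i -> v \in low G j.+1 ->
  exists c, A *m v - c *: v \in (low F i.+1 :&: low G j)%VS.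
Proof.
move=> hF hG hA h3 /lowP vi /lowP vj; exists (th (inord j)).
have GA h : G h *m A = th h *: G h.
  rewrite hA mulmx_sumr (bigD1 h) //= big1 => [|k kh].
    by rewrite -scalemxAr (res_mul hG) eqxx addr0.
  by rewrite -scalemxAr (res_mul hG) eq_sym (negPf kh) scaler0.
apply/memv_capP; split; apply/lowP=> h ih.
  rewrite mulmxBr -scalemxAr (vi h) 1?ltnW // scaler0 subr0.
  rewrite [v](resolution_expand _ hF) !mulmx_sumr big1 // => k _.
  have [ik|ki] := leqP i k; first by rewrite vi // !mulmx0.
  by rewrite !mulmxA h3 ?mul0mx //; lia.
rewrite mulmxBr mulmxA GA -scalemxAr -scalemxAl -scalerBl.
have [jh|hj] := ltnP j h; first by rewrite vj // scaler0.
have -> : inord j = h :> 'I_D.+1.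
  by apply/val_inj; rewrite /= inordK //; have := ltn_ord h; lia.
by rewrite subrr scale0r.
Qed.

(** * The filtration $N_r$, its layers and the pieces spanning $V$ *)

Definition filt F G (r : nat) : {vspace 'cV[C]_n} :=
  (\sum_(ij : 'I_D.+1 * 'I_D.+1 | (ij.1 + ij.2 < r)%N) (low F ij.1.+1 :&: low G ij.2.+1))%VS.

Lemma mem_filt F G r (i j : nat) v :
  (i + j < r)%N -> v \in low F i.+1 -> v \in low G j.+1 -> v \in filt F G r.
Proof.
move=> ijr vi vj.
have clip k : (inord (minn k D) : 'I_D.+1) = minn k D :> nat.
  by rewrite inordK // ltnS geq_minr.
have lowclip F' k : v \in low F' k.+1 -> v \in low F' (inord (minn k D) : 'I_D.+1).+1.
  move=> vk; rewrite clip; have [kD|Dk] := leqP k D; first by [].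
  by apply: low_ge; lia.
(* The sum runs over ordinals, so indices beyond [D] are clipped to [D], where the flag is already
   the whole space. *)
pose ij := (inord (minn i D) : 'I_D.+1, inord (minn j D) : 'I_D.+1).
apply: (subvP (sumv_sup ij _ (subvv _))); first by rewrite /ij /= !clip; lia.
by rewrite memv_cap !lowclip.
Qed.

Lemma filt_ind F G r (P : 'cV[C]_n -> Prop) :
  P 0 -> (forall u v, P u -> P v -> P (u + v)) ->
  (forall (i j : nat) v, (i <= D)%N -> (j <= D)%N -> (i + j < r)%N ->
     v \in low F i.+1 -> v \in low G j.+1 -> P v) ->
  forall v, v \in filt F G r -> P v.
Proof.
move=> P0 PD Pb v /memv_sumP[f fP ->]; apply: (big_ind P) => // -[i j] /= ijr.
by have /memv_capP[fi fj] := fP (i, j) ijr; apply: Pb ijr fi fj; rewrite -ltnS ltn_ord.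
Qed.

Lemma filt_mono F G r s v : (r <= s)%N -> v \in filt F G r -> v \in filt F G s.
Proof.
move=> rs; move: v; apply: filt_ind => [|u w|i j w _ _ ij]; [exact: mem0v|exact: memvD|].
by apply: mem_filt; lia.
Qed.

Lemma filt_full F G v : v \in filt F G (D + D).+1.
Proof. by apply: (@mem_filt _ _ _ D D); rewrite ?low_ge. Qed.

Lemma filt_sym F G r v : v \in filt F G r -> v \in filt G F r.
Proof.
move: v; apply: filt_ind => [|u w|i j w _ _ ij wi wj]; [exact: mem0v|exact: memvD|].
by apply: (@mem_filt _ _ _ j i) => //; lia.
Qed.

Lemma filt_conj F G r v : split_system F G -> v \in filt F G r -> cmx v \in filt F G r.
Proof.
case=> hF hG _ _; move: v; apply: filt_ind => [|u w uN wN|i j w _ _ ij wi wj].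
- by rewrite map_mx0 mem0v.
- by rewrite map_mxD memvD.
- by apply: (mem_filt ij); apply: low_conj.
Qed.

Lemma filt_commute F G r Z :
  (forall h, F h *m Z = Z *m F h) -> (forall h, G h *m Z = Z *m G h) ->
  preserves Z (filt F G r).
Proof.
move=> hF hG; apply: filt_ind => [|u w uN wN|i j w _ _ ij wi wj].
- by rewrite mulmx0 mem0v.
- by rewrite mulmxDr memvD.
- by apply: (mem_filt ij); apply: low_invariant.
Qed.

(** Up to a multiple of the vector itself, [A] sends the pair $(i,j)$ to $(i+1,j-1)$, with the same
    sum. So $N_r$ is stable under [A], hence under every [G h]. *)
Lemma filt_invariantr F G r h : split_system F G -> preserves (G h) (filt F G r).
Proof.
case=> hF hG [A [th [hA h3 hg]]] _; apply: hg.
apply: filt_ind => [|u w uN wN|i j w _ _ ij wi wj].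
- by rewrite mulmx0 mem0v.
- by rewrite mulmxDr memvD.
have [c /memv_capP[ci cj]] := raising hF hG hA h3 wi wj.
rewrite -[A *m w](subrK (c *: w)) memvD //; last first.
  by apply/memvZ/(mem_filt ij).
case: j ij wj cj => [|j] ij wj cj; first by rewrite (low0 hG cj) mem0v.
by apply: (@mem_filt _ _ _ i.+1 j) => //; lia.
Qed.

Lemma filt_invariantl F G r h : split_system F G -> preserves (F h) (filt F G r).
Proof.
move=> /split_system_sym/filt_invariantr h' v /filt_sym/h' vN.
by apply/filt_sym/vN.
Qed.

Lemma orth_filt_invariant F G r h : split_system F G ->
  preserves (F h) (orth (filt F G r)) /\ preserves (G h) (orth (filt F G r)).
Proof.
move=> S; split=> v; apply: orth_invariant.
  rewrite (res_conj (sys_resl S)) (res_tr (sys_resl S)); exact: filt_invariantl.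
rewrite (res_conj (sys_resr S)) (res_tr (sys_resr S)); exact: filt_invariantr.
Qed.

(* For $r = \rho + \tau + d$ this is the sum of the irreducible submodules of
   endpoint $\rho$, dual endpoint $\tau$ and diameter $d$, i.e. of
   displacement $r - D$. *)
Definition layer F G r : {vspace 'cV[C]_n} := (filt F G r.+1 :&: orth (filt F G r))%VS.

(** Orthogonality is asked to the whole of $N_{i+j}$, which contains $V_{i-1,j}+V_{i,j-1}$, so that
    each piece lies inside the module $M_{i+j}$. *)
Definition tilde F G i j : {vspace 'cV[C]_n} :=
  (low F i.+1 :&: low G j.+1 :&: orth (filt F G (i + j)))%VS.

Lemma tilde_layer F G i j v : v \in tilde F G i j -> v \in layer F G (i + j).
Proof.
case/memv_capP=> /memv_capP[vi vj] vo; apply/memv_capP; split=> //.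
exact: (mem_filt _ vi vj).
Qed.

Lemma layer_invariant F G r h : split_system F G ->
  preserves (F h) (layer F G r) /\ preserves (G h) (layer F G r).
Proof.
move=> S; have [hF hG] := orth_filt_invariant r h S.
split=> v /memv_capP[v1 v2]; apply/memv_capP; split; auto.
  exact: filt_invariantl.
exact: filt_invariantr.
Qed.

(** Projection to [U] commutes with [F h], as [U] and its complement are both stable. For $h\ge i$
    the vector [F h *m u] thus lies in [U] and in [orth U]. *)
Lemma orth_part_low F U i u v : real_resolution F ->
  (forall h, preserves (F h) U) -> (forall h, preserves (F h) (orth U)) ->
  v \in low F i -> u \in U -> v - u \in orth U -> u \in low F i.
Proof.
move=> hF iU iO /lowP vi uU vu; apply/lowP=> h ih.
apply: (@orth_self_eq0 _ _ U); first exact: iU.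
have := iO h _ vu; rewrite mulmxBr vi // sub0r => Fu.
by rewrite -[_ *m _]opprK rpredN.
Qed.

(** Splitting a generator with $i+j=a$ along $N_a$ and its complement keeps both parts in the two
    flags of the generator, so the complementary part lies in a [tilde] piece. *)
Lemma filt_step F G a (P : 'cV[C]_n -> Prop) : split_system F G ->
  P 0 -> (forall u v, P u -> P v -> P (u + v)) ->
  (forall (i j : nat) v, (i <= D)%N -> (j <= D)%N -> (i + j)%N = a ->
     v \in tilde F G i j -> P v) ->
  forall v, v \in filt F G a.+1 ->
  exists2 u, u \in filt F G a & P (v - u) /\ v - u \in orth (filt F G a).
Proof.
move=> S P0 PD Pt; apply: filt_ind => [|u v [u' uN [Pu uO]] [v' vN [Pv vO]]|].
- by exists 0; rewrite ?subr0 ?mem0v.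
- exists (u' + v'); first exact: memvD.
  by rewrite opprD addrACA; split; [apply: PD|apply: memvD].
move=> i j v iD jD ija vi vj; have [ia|ia] := ltnP (i + j) a.
  by exists v; rewrite ?subrr ?mem0v //; apply: mem_filt ia vi vj.
have {}ia : (i + j)%N = a by lia.
have [u uN uO] := orth_decomposition (filt F G a) v.
have iN h := (@filt_invariantl F G a h S, @filt_invariantr F G a h S).
have iO h := orth_filt_invariant a h S.
have ui : u \in low F i.+1.
  apply: (orth_part_low (sys_resl S) _ _ vi uN uO) => h; first by case: (iN h).
  by case: (iO h).
have uj : u \in low G j.+1.
  apply: (orth_part_low (sys_resr S) _ _ vj uN uO) => h; first by case: (iN h).
  by case: (iO h).
exists u => //; split=> //; apply: (Pt i j) => //.
by rewrite !memv_cap ia uO !memvB.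
Qed.

Lemma layer_ind F G a (P : 'cV[C]_n -> Prop) : split_system F G ->
  P 0 -> (forall u v, P u -> P v -> P (u + v)) ->
  (forall (i j : nat) v, (i <= D)%N -> (j <= D)%N -> (i + j)%N = a ->
     v \in tilde F G i j -> P v) ->
  forall v, v \in layer F G a -> P v.
Proof.
move=> S P0 PD Pt v /memv_capP[vN vO].
have [u uN [Pu uO]] := filt_step S P0 PD Pt vN.
suff u0 : u = 0 by rewrite u0 subr0 in Pu.
apply: (orth_self_eq0 uN).
by rewrite -[u](subKr v) memvB.
Qed.

(** The pieces span $V$: descend through the filtration from $N_{2D+1}=V$ to $N_0=0$. *)
Lemma tilde_ind F G (P : 'cV[C]_n -> Prop) : split_system F G ->
  P 0 -> (forall u v, P u -> P v -> P (u + v)) ->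
  (forall (i j : nat) v, (i <= D)%N -> (j <= D)%N -> v \in tilde F G i j -> P v) ->
  forall v, P v.
Proof.
move=> S P0 PD Pt v; have : v \in filt F G (D + D).+1 by apply: filt_full.
move: (D + D).+1 v; elim=> [|a IH].
  by apply: filt_ind => // i j w _ _; rewrite ltn0.
have Pt' (i j : nat) w : (i <= D)%N -> (j <= D)%N -> (i + j)%N = a ->
  w \in tilde F G i j -> P w by move=> iD jD _; apply: Pt.
move=> v /(filt_step S P0 PD Pt')[u uN [Pu _]].
by rewrite -[v](subrK u); apply: PD => //; apply: IH.
Qed.

Lemma layer_orth F G a b u v : u \in layer F G a -> v \in layer F G b ->
  a != b -> herm u v = 0.
Proof.
wlog ab : a b u v / (a < b)%N => [hw|] uL vL ne.
  have [ab|ba|e] := ltngtP a b; first exact: (hw a b).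
    by rewrite hermC (hw b a) ?conjC0 // eq_sym.
  by rewrite e eqxx in ne.
case/memv_capP: uL => uN _; case/memv_capP: vL => _ /orthP vO.
by rewrite hermC vO ?conjC0 // (filt_mono ab uN).
Qed.

(** The adjoint of the symmetric matrix [Z] is its conjugate, which commutes with the idempotents
    because they are real. So the complement of $N_{i+j}$ is stable under [Z]. *)
Lemma tilde_commute F G Z i j : split_system F G ->
  (forall h, F h *m Z = Z *m F h) -> (forall h, G h *m Z = Z *m G h) ->
  Z^T = Z -> preserves Z (tilde F G i j).
Proof.
move=> S hF hG hZ v /memv_capP[/memv_capP[vi vj] vo].
rewrite !memv_cap !(low_invariant _ vi, low_invariant _ vj) //=.
apply: orth_invariant vo => u; apply: filt_commute => h.
  rewrite -(res_conj (sys_resl S)) map_trmx hZ -!map_mxM.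
  by rewrite hF.
rewrite -(res_conj (sys_resr S)) map_trmx hZ -!map_mxM.
by rewrite hG.
Qed.

Lemma tilde_conj F G i j v : split_system F G ->
  v \in tilde F G i j -> cmx v \in tilde F G i j.
Proof.
move=> S /memv_capP[/memv_capP[vi vj] /orthP vo].
rewrite !memv_cap (low_conj (sys_resl S) vi) (low_conj (sys_resr S) vj) /=.
apply/orthP=> u uN; rewrite -[u]cmxK herm_conj vo ?conjC0 //.
exact: filt_conj.
Qed.

(** * Duality between opposite orderings *)

Lemma low_flip_orth F i k u v : real_resolution F -> (i + k <= D.+1)%N ->
  u \in low F i -> v \in low (flip F) k -> herm u v = 0.
Proof.
move=> hF ik /lowP ui /lowP vk; rewrite [v](resolution_expand _ hF) herm_sumr.
apply: big1 => h _; rewrite -(res_tr hF) -{1}(res_conj hF) -herm_mulmx.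
have [ih|hi] := leqP i h; first by rewrite ui // herm0l.
rewrite resolution_herm //.
have := vk (rev_ord h); rewrite /flip /= rev_ordK => ->; first by rewrite herm0r.
by have := ltn_ord h; lia.
Qed.

(** For $l<i$ the vector $F_lw$ lies in $U\cap F_{<i}V$, so $\|F_lw\|^2=\langle w,F_lw\rangle=0$. As
    $D<i+k$, this covers every $l\le D-k$. *)
Lemma orth_low_flip F U i k w : real_resolution F -> (forall h, preserves (F h) U) ->
  (D < i + k)%N -> w \in U -> w \in orth (U :&: low F i) -> w \in low (flip F) k.
Proof.
move=> hF iU ik wU /orthP wo; apply/lowP=> h kh; rewrite /flip /=.
set l := rev_ord h; apply: herm_definite.
rewrite resolution_herm // mulmxA (res_mul hF) eqxx; apply: wo.
rewrite memv_cap iU //=; apply/lowP=> m im; rewrite mulmxA (res_mul hF).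
case: eqP => [ml|_]; last by rewrite mul0mx.
by move: im; rewrite ml /l /=; have := ltn_ord h; lia.
Qed.

(** Every cut [i] splits [M] into a lower [F]-part and a lower [G]-part. Letting [i] grow, the
    modular law moves all of [M] into $N_{c+1}$ one flag at a time. *)
Lemma layer_flip_sub F G b : split_system F G -> (b <= D + D)%N ->
  (layer (flip F) (flip G) b <= filt F G (D + D - b).+1)%VS.
Proof.
move=> S bD; set M := layer _ _ b; set c := (D + D - b)%N.
have S' : split_system (flip F) (flip G) by apply/split_system_flipl/split_system_flipr.
have flipK H h : flip H (rev_ord h) = H h by rewrite /flip /= rev_ordK.
have iF h : preserves (F h) M.
  by rewrite -flipK; case: (layer_invariant b (rev_ord h) S').
have iG h : preserves (G h) M.
  by rewrite -flipK; case: (layer_invariant b (rev_ord h) S').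
(* A vector of [M] orthogonal to both summands lies in the upper flags of indices $D-i$ and
   $D-(c+1-i)$. If the second is negative the vector is zero. Otherwise the indices add up to less
   than [b], so it lies in $N^{\uparrow\uparrow}_b$, to which [M] is orthogonal. *)
have split_at i : (i <= D)%N ->
    (M <= (M :&: low F i) + (M :&: low G (c.+1 - i)))%VS.
  move=> iD; apply: orth_trivial_sub => [|w wM /orthP wo].
    by rewrite subv_add !capvSl.
  have wi : w \in low (flip F) (D - i).+1.
    apply: (@orth_low_flip F M i) => //; [exact: (sys_resl S)|lia|].
    by apply/orthP=> u uI; apply: wo; apply: (subvP (addvSl _ _)).
  have wj : w \in low (flip G) (D.+1 - (c.+1 - i)).
    apply: (@orth_low_flip G M (c.+1 - i)) => //; [exact: (sys_resr S)|lia|].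
    by apply/orthP=> u uI; apply: wo; apply: (subvP (addvSr _ _)).
  have [cD|cD] := leqP D.+1 (c.+1 - i).
    have e0 : (D.+1 - (c.+1 - i) = 0)%N by lia.
    by rewrite e0 in wj; apply: (low0 (sys_resr S') wj).
  have e1 : (D.+1 - (c.+1 - i) = (D - (c.+1 - i)).+1)%N by lia.
  rewrite e1 in wj.
  case/memv_capP: wM => _ wO; apply: orth_self_eq0 wO.
  by apply: mem_filt wi wj; lia.
have step i : (i <= D.+1)%N -> (M :&: low F i <= filt F G c.+1)%VS.
  elim: i => [|i IH] iD; apply/subvP=> v /memv_capP[vM vi].
    by rewrite (low0 (sys_resl S) vi) mem0v.
  have /memv_addP[a aI [g gI va]] := subvP (split_at i iD) v vM.
  have aN := subvP (IH (ltnW iD)) _ aI.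
  rewrite va memvD //.
  case/memv_capP: aI => _ ai; case/memv_capP: gI => _ gj.
  (* Modular law: [g] is the difference of [v] and [a], so it inherits the flag of [v]. It is then
     either zero or in the flags of indices [i] and $c-i$, of sum [c]. *)
  have gi : g \in low F i.+1.
    by rewrite -[g](addKr a) addrC -va memvB // (low_mono _ ai).
  case ej : (c.+1 - i)%N gj => [|j] gj; first by rewrite (low0 (sys_resr S) gj) mem0v.
  by apply: (mem_filt _ gi gj); lia.
apply/subvP=> v vM; apply: (subvP (step D.+1 _)) => //.
by rewrite memv_cap vM low_ge.
Qed.

(** If $i+r<D$ or $j+s<D$, two flags use disjoint sets of idempotents. If the four indices add up to
    more than $2D$, then [v] lies in $N_{i+j}$ by [layer_flip_sub], and [u] is orthogonal to it. *)
Lemma tilde_dual F G i j r s u v : split_system F G -> (r <= D)%N -> (s <= D)%N ->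
  u \in tilde F G i j -> v \in tilde (flip F) (flip G) r s ->
  herm u v = 0 \/ (i + r = D /\ j + s = D)%N.
Proof.
move=> S rD sD uT vT.
case/memv_capP: (uT) => /memv_capP[ui uj] /orthP uo.
case/memv_capP: (vT) => /memv_capP[vr vs] _.
have [ir|ir] := ltnP (i + r) D.
  by left; apply: (low_flip_orth (sys_resl S) _ ui vr); lia.
have [js|js] := ltnP (j + s) D.
  by left; apply: (low_flip_orth (sys_resr S) _ uj vs); lia.
have [e|ne] := eqVneq (i + j + (r + s))%N (D + D)%N; first by right; lia.
left; apply: uo; apply: (@filt_mono _ _ (D + D - (r + s)).+1); first by lia.
by apply: (subvP (layer_flip_sub S _)); [lia|exact: tilde_layer].
Qed.

End SplitSystem.

(** * Transposes of the split operators *)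

Section Actions.
Variables (C : numClosedFieldType) (n D : nat).
Implicit Types (F G : 'I_D.+1 -> 'M[C]_n) (u v w : 'cV[C]_n) (mu nu : arrow).

Lemma mem_col_space (M : 'M[C]_n) v :
  reflect (exists w, v = M *m w) (v \in col_space M).
Proof.
apply: (iffP memv_imgP) => [[w _ ->]|[w ->]].
  by exists w; rewrite lfunE.
by exists w; rewrite ?memvf // lfunE.
Qed.

Lemma arrow_sum_down F (k : nat) : real_resolution F ->
  arrow_sum down F (k%:Z - 1) = low F k.
Proof.
move=> hF; have cond (h : 'I_D.+1) : (h%:Z <= k%:Z - 1)%R = (h < k)%N by lia.
apply/vspaceP=> v; apply/idP/idP => [/memv_sumP[f fP ->]|/lowP vk].
  apply/lowP=> h kh; rewrite mulmx_sumr big1 // => l; rewrite cond => lk.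
  have [|w ->] := mem_col_space _ _ (fP l _); first by rewrite cond.
  by rewrite mulmxA (res_mul hF) -val_eqE /= gtn_eqF ?mul0mx // (leq_trans lk).
rewrite [v](resolution_expand _ hF); apply: memv_suml => h _.
have [hk|kh] := ltnP h k; last by rewrite vk // mem0v.
apply: (subvP (sumv_sup h _ (subvv _))); first by rewrite cond.
by apply/mem_col_space; exists v.
Qed.

Lemma arrow_sum_up F (i : int) : arrow_sum up F i = arrow_sum down (flip F) i.
Proof.
rewrite /arrow_sum (reindex_inj rev_ord_inj); apply: eq_bigl => h /=.
by have := ltn_ord h; lia.
Qed.

Definition orient mu F := if mu is up then flip F else F.

Lemma real_resolution_orient mu F : real_resolution F -> real_resolution (orient mu F).
Proof. by case: mu => //=; apply: real_resolution_flip. Qed.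

Lemma arrow_sum_orient mu F (k : nat) : real_resolution F ->
  arrow_sum mu F (k%:Z - 1) = low (orient mu F) k.
Proof.
move=> hF; case: mu; first exact: arrow_sum_down.
by rewrite arrow_sum_up; apply/arrow_sum_down/real_resolution_flip.
Qed.

(** Since $V_{i-1,j}+V_{i,j-1}\subseteq N_{i+j}$, each [tilde] piece lies in the split space on
    which the action is prescribed. *)
Lemma acts_on_tilde mu nu F G lam M (i j : nat) v : split_system F G ->
  acts_on_split F G mu nu lam M -> (i <= D)%N -> (j <= D)%N ->
  v \in tilde (orient mu F) (orient nu G) i j -> M *m v = lam i%:Z j%:Z *: v.
Proof.
move=> S act iD jD /memv_capP[vij /orthP vo].
have hF := sys_resl S; have hG := sys_resr S.
have pred1 (k : nat) : k%:Z = k.+1%:Z - 1 by lia.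
have := act (Ordinal (iD : (i < D.+1)%N)) (Ordinal (jD : (j < D.+1)%N)) v.
apply; split => /=; first by rewrite /split_space (pred1 i) (pred1 j) !arrow_sum_orient.
move=> u uN; apply: vo; move: uN; rewrite /split_space.
rewrite (arrow_sum_orient _ i) // (arrow_sum_orient _ j) //.
rewrite (pred1 i) (pred1 j) !arrow_sum_orient //.
case/memv_addP=> a /memv_capP[ai aj] [c /memv_capP[ci cj] ->].
apply: memvD.
  case: i {vij iD} ai {ci} => [|i] ai.
    by rewrite (low0 (real_resolution_orient mu hF) ai) mem0v.
  by apply: mem_filt ai aj; lia.
case: j {vij jD aj} cj => [|j] cj.
  by rewrite (low0 (real_resolution_orient nu hG) cj) mem0v.
by apply: mem_filt ci cj; lia.
Qed.

Lemma bilinear_ext F G F' G' (Y Z : 'M[C]_n) :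
  split_system F G -> split_system F' G' ->
  (forall (i j r s : nat) u v, (i <= D)%N -> (j <= D)%N -> (r <= D)%N -> (s <= D)%N ->
     u \in tilde F G i j -> v \in tilde F' G' r s -> u^T *m Y *m v = u^T *m Z *m v) ->
  Y = Z.
Proof.
move=> S S' h.
have huv u v : u^T *m Y *m v = u^T *m Z *m v.
  move: u; apply: (tilde_ind S) => [|a c ha hc|i j u iD jD uT].
  - by rewrite trmx0 !mul0mx.
  - by rewrite linearD /= !mulmxDl ha hc.
  move: v; apply: (tilde_ind S') => [|a c ha hc|r s v rD sD vT].
  - by rewrite !mulmx0.
  - by rewrite !mulmxDr ha hc.
  exact: h iD jD rD sD uT vT.
apply/matrixP=> i j; have := huv (delta_mx i 0) (delta_mx j 0).
by rewrite trmx_delta -!rowE -!colE => /matrixP/(_ 0 0); rewrite !mxE.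
Qed.

(** * Operators that are scalar on the pieces *)

Definition scales F G (lam : nat -> nat -> C) (M : 'M[C]_n) :=
  forall (i j : nat) v, (i <= D)%N -> (j <= D)%N -> v \in tilde F G i j ->
    M *m v = lam i j *: v.

(** Here $u^tv$ is the Hermitian product of [u] with the conjugate of [v], which lies in the same
    piece as [v]. *)
Lemma tilde_dual_bilinear F G i j r s u v : split_system F G ->
  (r <= D)%N -> (s <= D)%N ->
  u \in tilde F G i j -> v \in tilde (flip F) (flip G) r s ->
  u^T *m v = 0 \/ (i + r = D /\ j + s = D)%N.
Proof.
move=> S rD sD uT vT.
have S' : split_system (flip F) (flip G) by apply/split_system_flipl/split_system_flipr.
have [h|h] := tilde_dual S rD sD uT (tilde_conj S' vT); last by right.
by left; apply/matrixP=> a c; rewrite !ord1 -herm_conjr h mxE.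
Qed.

(** On a pair of pieces the forms of [M^T] and [M'] are $u^tv$ times the respective eigenvalues, and
    $u^tv$ vanishes unless the indices are complementary. *)
Lemma dual_trmx F G lam lam' M M' : split_system F G ->
  scales F G lam M -> scales (flip F) (flip G) lam' M' ->
  (forall i j r s : nat, (i + r = D)%N -> (j + s = D)%N -> lam i j = lam' r s) ->
  M^T = M'.
Proof.
move=> S sM sM' e.
have S' : split_system (flip F) (flip G) by apply/split_system_flipl/split_system_flipr.
apply: (bilinear_ext S S') => i j r s u v iD jD rD sD uT vT.
rewrite -trmx_mul (sM i j) // -mulmxA (sM' r s) // linearZ /= -scalemxAl -scalemxAr.
have [->|[ir js]] := tilde_dual_bilinear S rD sD uT vT; first by rewrite !scaler0.
by rewrite (e _ _ _ _ ir js).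
Qed.

Lemma dual_trmx_inv F G lam lam' M M' : split_system F G ->
  scales F G lam M -> scales (flip F) (flip G) lam' M' ->
  (forall i j r s : nat, (i + r = D)%N -> (j + s = D)%N -> lam i j * lam' r s = 1) ->
  M^T *m M' = 1%:M.
Proof.
move=> S sM sM' e.
have S' : split_system (flip F) (flip G) by apply/split_system_flipl/split_system_flipr.
apply: (bilinear_ext S S') => i j r s u v iD jD rD sD uT vT.
rewrite mulmx1 mulmxA -trmx_mul (sM i j) // -mulmxA (sM' r s) //.
rewrite [(_ *: u)^T]linearZ /= -scalemxAl -scalemxAr scalerA.
have [->|[ir js]] := tilde_dual_bilinear S rD sD uT vT; first by rewrite !scaler0.
by rewrite (e _ _ _ _ ir js) scale1r.
Qed.

(** The scalar is constant on each layer, and distinct layers are orthogonal for $u^tv$ too, since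
    pieces are closed under conjugation. *)
Lemma scales_sym F G (f : nat -> C) M : split_system F G ->
  scales F G (fun i j => f (i + j)%N) M -> M^T = M.
Proof.
move=> S sM; apply: (bilinear_ext S S) => i j r s u v iD jD rD sD uT vT.
rewrite -trmx_mul (sM i j) // -mulmxA (sM r s) // linearZ /= -scalemxAl -scalemxAr.
have [->//|ne] := eqVneq (i + j)%N (r + s)%N.
suff -> : u^T *m v = 0 by rewrite !scaler0.
apply/matrixP=> a c; rewrite !ord1 -herm_conjr mxE.
exact: (layer_orth (tilde_layer uT) (tilde_layer (tilde_conj S vT)) ne).
Qed.

Lemma mx_ext (Y Z : 'M[C]_n) : (forall v : 'cV[C]_n, Y *m v = Z *m v) -> Y = Z.
Proof.
move=> h; apply/matrixP=> i j; have := h (delta_mx j 0).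
by rewrite -!colE => /matrixP/(_ i 0); rewrite !mxE.
Qed.

(** [M] is the scalar [f a] on the layer of index [a], and that layer is stable under every [F h]
    and [G h]. *)
Lemma scales_central F G (f : nat -> C) M : split_system F G ->
  scales F G (fun i j => f (i + j)%N) M ->
  (forall h, F h *m M = M *m F h) /\ (forall h, G h *m M = M *m G h).
Proof.
move=> S sM.
have lay a v : v \in layer F G a -> M *m v = f a *: v.
  move: v; apply: (layer_ind S) => [|u v hu hv|i j v iD jD <- vT].
  - by rewrite mulmx0 scaler0.
  - by rewrite mulmxDr scalerDr hu hv.
  exact: sM vT.
suff c Z : (forall a, preserves Z (layer F G a)) -> Z *m M = M *m Z.
  by split=> h; apply: c => a; case: (layer_invariant a h S).
move=> iZ; apply: mx_ext; apply: (tilde_ind S) => [|u v hu hv|i j v iD jD vT].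
- by rewrite !mulmx0.
- by rewrite !mulmxDr hu hv.
rewrite -!mulmxA (sM i j) // (lay (i + j)%N) -?scalemxAr //.
by apply: iZ; apply: tilde_layer.
Qed.

Lemma scales_commute F G lam M Z : split_system F G -> scales F G lam M ->
  (forall h, F h *m Z = Z *m F h) -> (forall h, G h *m Z = Z *m G h) -> Z^T = Z ->
  Z *m M = M *m Z.
Proof.
move=> S sM hF hG hZ; apply: mx_ext.
apply: (tilde_ind S) => [|u v hu hv|i j v iD jD vT].
- by rewrite !mulmx0.
- by rewrite !mulmxDr hu hv.
rewrite -!mulmxA (sM i j v) // (sM i j) -?scalemxAr //.
exact: tilde_commute.
Qed.

Lemma flipK F : flip (flip F) = F.
Proof. by apply: boolp.funext => h; rewrite /flip /= rev_ordK. Qed.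

Lemma comm_invmx (Y Z : 'M[C]_n) : Y *m Z = Z *m Y -> invmx Y *m Z = Z *m invmx Y.
Proof.
(* By convention [invmx] of a non-unit is the matrix itself. *)
move=> YZ; have [uY|nY] := boolP (Y \in unitmx); last by rewrite /invmx (negPf nY).
by rewrite -[Z in LHS](mulmxK uY) -YZ -!mulmxA mulKmx.
Qed.

Lemma split_transpose F G (q : C) (B Bs K Ks Phi Psi : 'M[C]_n) :
  split_system F G -> q != 0 ->
  let A := \sum_(i < D.+1) q ^ (D%:Z - 2 * i%:Z) *: G i in
  let As := \sum_(i < D.+1) q ^ (D%:Z - 2 * i%:Z) *: F i in
  acts_on_split F G down up (fun i j => q ^ (i - j)) B ->
  acts_on_split F G up down (fun i j => q ^ (j - i)) Bs ->
  acts_on_split F G down down (fun i j => q ^ (i - j)) K ->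
  acts_on_split F G up up (fun i j => q ^ (i - j)) Ks ->
  acts_on_split F G down down (fun i j => q ^ (i + j - D%:Z)) Phi ->
  acts_on_split F G down up (fun i j => q ^ (i + j - D%:Z)) Psi ->
  let x01 := A *m Phi *m invmx Psi in
  let x12 := B *m invmx Phi in
  let x23 := As *m Phi *m Psi in
  let x30 := Bs *m invmx Phi in
  let x02 := K *m invmx Psi in
  let x20 := Psi *m invmx K in
  let x13 := Ks *m Psi in
  let x31 := invmx Psi *m invmx Ks in
  [/\ x01^T = x01, x12^T = x30, x23^T = x23 & x30^T = x12] /\
  [/\ x02^T = x31, x20^T = x13, x13^T = x20 & x31^T = x02].
Proof.
move=> S q0 A As aB aBs aK aKs aPhi aPsi /=.
have Sud := split_system_flipl S; have Sdu := split_system_flipr S.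
have sB : scales F (flip G) (fun i j => q ^ (i%:Z - j%:Z)) B.
  by move=> i j v iD jD vT; rewrite (acts_on_tilde S aB iD jD vT).
have sBs : scales (flip F) G (fun i j => q ^ (j%:Z - i%:Z)) Bs.
  by move=> i j v iD jD vT; rewrite (acts_on_tilde S aBs iD jD vT).
have sK : scales F G (fun i j => q ^ (i%:Z - j%:Z)) K.
  by move=> i j v iD jD vT; rewrite (acts_on_tilde S aK iD jD vT).
have sKs : scales (flip F) (flip G) (fun i j => q ^ (i%:Z - j%:Z)) Ks.
  by move=> i j v iD jD vT; rewrite (acts_on_tilde S aKs iD jD vT).
pose f k := q ^ (k%:Z - D%:Z).
have sPhi : scales F G (fun i j => f (i + j)%N) Phi.
  by move=> i j v iD jD vT; rewrite (acts_on_tilde S aPhi iD jD vT).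
have sPsi : scales F (flip G) (fun i j => f (i + j)%N) Psi.
  by move=> i j v iD jD vT; rewrite (acts_on_tilde S aPsi iD jD vT).
have tPhi := scales_sym S sPhi; have tPsi := scales_sym Sdu sPsi.
have [FPhi GPhi] := scales_central S sPhi; have [FPsi Gf] := scales_central Sdu sPsi.
have GPsi h : G h *m Psi = Psi *m G h by rewrite -[h]rev_ordK; apply: Gf.
(* [Phi] is symmetric and commutes with all idempotents, so it preserves the pieces on which [Psi],
   [B] and [Bs] are scalar. *)
have PhiPsi : Phi *m Psi = Psi *m Phi.
  by apply: (scales_commute Sdu sPsi FPhi _ tPhi) => h; apply: GPhi.
have PhiB : Phi *m B = B *m Phi.
  by apply: (scales_commute Sdu sB FPhi _ tPhi) => h; apply: GPhi.
have PhiBs : Phi *m Bs = Bs *m Phi.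
  by apply: (scales_commute Sud sBs _ GPhi tPhi) => h; apply: FPhi.
(* The arrow types are opposite, and $i+r=j+s=D$ gives $i-j=s-r$. *)
have tB : B^T = Bs.
  apply: (dual_trmx Sdu sB); first by rewrite flipK; exact: sBs.
  by move=> i j r s ir js; congr (q ^ _); lia.
(* Here the exponents $i-j$ and $r-s$ cancel, so the eigenvalues are inverse to each other. *)
have KKs : K^T *m Ks = 1%:M.
  apply: (dual_trmx_inv S sK sKs) => i j r s ir js.
  by rewrite -expfzDr // -[RHS](expr0z q); congr (q ^ _); lia.
have [uKt uKs] := mulmx1_unit KKs.
have iKs : invmx Ks = K^T by rewrite -[RHS](mulmxK uKs) KKs mul1mx.
have tKs : Ks^T = invmx K.
  by apply: trmx_inj; rewrite trmxK trmx_inv -iKs invmxK.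
have comm_sum (H : 'I_D.+1 -> 'M[C]_n) c (Z : 'M[C]_n) : (forall h, H h *m Z = Z *m H h) ->
    (\sum_(i < D.+1) c i *: H i) *m Z = Z *m (\sum_(i < D.+1) c i *: H i).
  move=> hH; rewrite mulmx_suml mulmx_sumr; apply: eq_bigr => i _.
  by rewrite -scalemxAl hH scalemxAr.
have tr_sum (H : 'I_D.+1 -> 'M[C]_n) c : real_resolution H ->
    (\sum_(i < D.+1) c i *: H i)^T = \sum_(i < D.+1) c i *: H i.
  move=> hH; rewrite linear_sum; apply: eq_bigr => i _.
  by rewrite linearZ /= (res_tr hH).
have tA : A^T = A by apply: tr_sum (sys_resr S).
have tAs : As^T = As by apply: tr_sum (sys_resl S).
have APhi : A *m Phi = Phi *m A by apply: comm_sum.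
have APsi : A *m Psi = Psi *m A by apply: comm_sum.
have AsPhi : As *m Phi = Phi *m As by apply: comm_sum.
have AsPsi : As *m Psi = Psi *m As by apply: comm_sum.
split; split; rewrite ?trmx_mul ?trmx_inv ?trmxK ?tA ?tAs ?tB ?tPhi ?tPsi ?tKs //.
- by rewrite -APhi (comm_invmx (Z := A *m Phi)) // mulmxA -APsi -!mulmxA PhiPsi.
- exact: comm_invmx.
- by rewrite -AsPhi mulmxA -AsPsi -!mulmxA PhiPsi.
- by rewrite -tB trmxK; apply: comm_invmx.
- by rewrite iKs.
- by rewrite -iKs invmxK.
- by rewrite invmxK.
Qed.

End Actions.

(** * Positivity of the trace form, and spans *)

Lemma mxtrace_definite (C : numClosedFieldType) m (N : 'M[C]_m) :
  \tr (N *m (cmx N)^T) = 0 -> N = 0.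
Proof.
move=> h; have pos s t : 0 <= N s t * (N s t)^* by rewrite mul_conjC_ge0.
have hs : \sum_s \sum_t N s t * (N s t)^* = 0.
  rewrite -[RHS]h; apply: eq_bigr => s _; rewrite mxE; apply: eq_bigr => t _.
  by rewrite !mxE.
apply/matrixP=> s t; rewrite mxE.
have {}hs : \sum_t N s t * (N s t)^* = 0.
  by apply: (psumr_eq0P _ hs) => // k _; apply: sumr_ge0.
have ht : N s t * (N s t)^* = 0 by apply: (psumr_eq0P _ hs).
by apply/eqP; rewrite -normr_eq0 -sqrf_eq0 normCK ht.
Qed.

Lemma span_ind (K : fieldType) (V : vectType K) (s : seq V) (P : V -> Prop) :
  P 0 -> (forall u v, P u -> P v -> P (u + v)) -> (forall a v, P v -> P (a *: v)) ->
  (forall v, v \in s -> P v) -> forall v, v \in <<s>>%VS -> P v.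
Proof.
move=> P0 PD PZ Ps v vs; rewrite (coord_span (X := in_tuple s) vs).
by apply: (big_ind P) => // i _; apply/PZ/Ps/mem_nth.
Qed.

Lemma span_combination (K : fieldType) (V : vectType K) (I : finType) (f : I -> V) s v :
  (forall w, w \in s -> exists i, w = f i) -> v \in <<s>>%VS ->
  exists a : I -> K, v = \sum_i a i *: f i.
Proof.
move=> hs; move: v; apply: span_ind => [|u v [a ->] [c ->]|k v [a ->]|w /hs[i ->]].
- by exists (fun=> 0); rewrite big1 // => i _; rewrite scale0r.
- exists (fun i => a i + c i); rewrite -big_split; apply: eq_bigr => i _.
  by rewrite scalerDl.
- exists (fun i => k * a i); rewrite scaler_sumr; apply: eq_bigr => i _.
  by rewrite scalerA.
exists (fun j => (j == i)%:R); rewrite (bigD1 i) //= eqxx scale1r big1 ?addr0 //.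
by move=> j /negPf->; rewrite scale0r.
Qed.

Lemma preserves_combination (C : numClosedFieldType) m (I : finType)
    (f : I -> 'M[C]_m) (a : I -> C) (U : {vspace 'cV[C]_m}) :
  (forall i, preserves (f i) U) -> preserves (\sum_i a i *: f i) U.
Proof.
move=> hf v vU; rewrite mulmx_suml; apply: memv_suml => i _.
by rewrite -scalemxAl memvZ // hf.
Qed.

(** * Distances and intersection numbers *)

Section Distance.
Variables (X : finType) (e : rel X).
Hypotheses (e_sym : symmetric e) (e_connected : connected_graph e).

Lemma walkP (x y : X) k :
  reflect (exists p : seq X, [/\ size p = k, path e x p & last x p = y])
    (walk_of_length e x y k).
Proof.
apply: (iffP existsP) => [[p /andP[xp /eqP ly]]|[p [sp xp ly]]].
  by exists p; split; rewrite ?size_tuple.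
by move/eqP in sp; exists (Tuple sp); rewrite /= xp ly eqxx.
Qed.

Lemma dist_le_walk x y k : walk_of_length e x y k -> (dist e x y <= k)%N.
Proof.
(* For $k\ge|X|$ the bound holds because [find] never exceeds the length [#|X|] of the list. *)
move=> w; have [kX|Xk] := ltnP k #|X|; last first.
  by apply: leq_trans (find_size _ _) _; rewrite size_iota.
rewrite leqNgt; apply/negP=> /(before_find 0)%N.
by rewrite nth_iota // add0n w.
Qed.

Lemma dist_walk x y : walk_of_length e x y (dist e x y).
Proof.
have [p xp ->] := connectP (e_connected x y).
have [p' xp' up' _] := shortenP xp.
have h : has (walk_of_length e x (last x p')) (iota 0 #|X|).
  apply/hasP; exists (size p'); last by apply/walkP; exists p'.
  by rewrite mem_iota /= add0n -[(_ < _)%N]/(size (x :: p') <= _)%N -(card_uniqP up') max_card.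
have := nth_find 0%N h; rewrite nth_iota ?add0n //.
by rewrite -[X in (_ < X)%N](size_iota 0) -has_find.
Qed.

Lemma dist_triangle x y z : (dist e x z <= dist e x y + dist e y z)%N.
Proof.
have /walkP[p [sp xp ly]] := dist_walk x y; have /walkP[r [sr yr lz]] := dist_walk y z.
apply: dist_le_walk; apply/walkP; exists (p ++ r).
by rewrite size_cat sp sr cat_path last_cat xp ly yr.
Qed.

Lemma dist_sym x y : dist e x y = dist e y x.
Proof.
suff le a c : (dist e a c <= dist e c a)%N by apply/eqP; rewrite eqn_leq !le.
have /walkP[p [sp cp la]] := dist_walk c a.
apply: dist_le_walk; apply/walkP; exists (rev (belast c p)); split.
- by rewrite size_rev size_belast.
- by rewrite -la rev_path (eq_path (e' := e)).
- by case: p {sp cp} la => [|d p] //= _; rewrite rev_cons last_rcons.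
Qed.

Lemma dist_eq0 x y : (dist e x y == 0)%N = (x == y).
Proof.
apply/idP/eqP => [/eqP h|->].
  by have /walkP[p [+ _ <-]] := dist_walk x y; rewrite h => /size0nil->.
by rewrite -leqn0; apply: dist_le_walk; apply/walkP; exists [::].
Qed.

Lemma dist_step x y k : dist e x y = k.+1 ->
  exists z, dist e x z = 1%N /\ dist e z y = k.
Proof.
move=> h; have /walkP[[|z p] [sp xp ly]] := dist_walk x y; first by rewrite h in sp.
move: xp => /= /andP[xz zp]; exists z.
have h1 : (dist e x z <= 1)%N.
  by apply: dist_le_walk; apply/walkP; exists [:: z]; rewrite /= xz.
have h2 : (dist e z y <= k)%N.
  apply: dist_le_walk; apply/walkP; exists p; split=> //.
  by move: sp; rewrite h => -[].
by have := dist_triangle x z y; lia.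
Qed.

Lemma dist_le_diameter x y : (dist e x y <= diameter e)%N.
Proof.
apply: leq_trans (leq_bigmax (F := fun x => \max_(y : X) dist e x y)%N x).
exact: (leq_bigmax (F := fun y => dist e x y)).
Qed.

(** [distance_regular] speaks of [p h] only for distances [h] that occur. A pair for each [h] is
    found along a geodesic between two vertices at maximal distance. *)
Lemma dist_attained (x0 : X) k : (k <= diameter e)%N -> exists x y, dist e x y = k.
Proof.
have X0 : (0 < #|X|)%N by apply/card_gt0P; exists x0.
have [x dx] := bigop.eq_bigmax (fun x => \max_(y : X) dist e x y)%N X0.
have [y dy] := bigop.eq_bigmax (fun y => dist e x y) X0.
move=> /subKn <-; elim: (diameter e - k)%N => [|m [u [v uv]]].
  by exists x, y; rewrite subn0 /diameter dx dy.
case Em : (diameter e - m)%N uv => [|l] uv.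
  by exists u, v; rewrite uv; lia.
have [z [_ zv]] := dist_step uv; exists z, v; rewrite zv; lia.
Qed.

Section Intersection.
Variables (p : nat -> nat -> nat -> nat) (x0 : X).
Hypothesis e_dist_regular : distance_regular e p.

Lemma intersection_triangle h i j : (h <= diameter e)%N -> p h i j != 0%N ->
  [&& h <= i + j, i <= h + j & j <= h + i]%N.
Proof.
move=> /(dist_attained x0)[x [y xy]]; rewrite -xy -e_dist_regular.
rewrite cards_eq0 => /set0Pn[z]; rewrite inE => /andP[/eqP xz /eqP zy].
have := dist_triangle x z y; have := dist_triangle x y z; have := dist_triangle z x y.
by rewrite (dist_sym y z) (dist_sym z x) xz zy; lia.
Qed.

Lemma intersection_0l h j : (h <= diameter e)%N -> p h 0 j = (h == j).
Proof.
move=> /(dist_attained x0)[x [y xy]]; rewrite -xy -e_dist_regular.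
have -> : [set z | (dist e x z == 0)%N && (dist e z y == j)] =
    if dist e x y == j then [set x] else set0.
  apply/setP=> z; rewrite inE dist_eq0 eq_sym; case: eqP => [->|/eqP zx] /=.
    by case: ifP => _; rewrite inE ?eqxx.
  by case: ifP => _; rewrite inE // (negPf zx).
by case: ifP => _; rewrite ?cards1 ?cards0.
Qed.

Lemma intersection_c_neq0 j : (j < diameter e)%N -> p j.+1 1 j != 0%N.
Proof.
move=> /(dist_attained x0)[x [y xy]]; have [z [xz zy]] := dist_step xy.
rewrite -xy -e_dist_regular cards_eq0; apply/set0Pn; exists z.
by rewrite inE xz zy !eqxx.
Qed.

End Intersection.
End Distance.

(** * The Terwilliger algebra of a self-dual Q-polynomial graph *)

Section Scheme.
Variables (C : numClosedFieldType) (X : finType) (e : rel X) (D : nat).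
Variables (p : nat -> nat -> nat -> nat) (E : 'I_D.+1 -> 'M[C]_#|X|) (x : X).
Hypotheses (e_sym : symmetric e) (e_connected : connected_graph e).
Hypotheses (e_dist_regular : distance_regular e p) (e_diameter : diameter e = D).
Hypothesis (D_gt0 : (0 < D)%N).
Hypotheses (E_primitive : primitive_idempotents e E).
Hypothesis (E_krein : Krein_parameters E (fun h i j => (p h i j)%:R)).

Local Notation "'Adj' i" := (distance_matrix C e i) (at level 10).
Local Notation BM := (Bose_Mesner C e D).
Local Notation Es := (dual_idempotent C e x (D := D)).

Let card_neq0 : #|X|%:R != 0 :> C.
Proof. by rewrite pnatr_eq0 -lt0n; apply/card_gt0P; exists x. Qed.

Let distD y z : (dist e y z < D.+1)%N.
Proof. by rewrite ltnS -e_diameter dist_le_diameter. Qed.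

(** * The Bose-Mesner algebra and its idempotents *)

Lemma Adj_in_BM (i : 'I_D.+1) : Adj i \in BM.
Proof. by apply/memv_span/map_f; rewrite mem_iota ltn_ord. Qed.

Lemma BM_combination_Adj M : M \in BM -> exists a : 'I_D.+1 -> C, M = \sum_i a i *: Adj i.
Proof.
apply: span_combination => w; case/mapP=> i; rewrite mem_iota add0n => /andP[_ iD] ->.
by exists (Ordinal iD).
Qed.

Lemma E_in_BM i : E i \in BM.
Proof.
have [/andP[/eqP <- _] _ _] := E_primitive.
by apply/memv_span/codom_f.
Qed.

Lemma BM_combination_E M : M \in BM -> exists a : 'I_D.+1 -> C, M = \sum_i a i *: E i.
Proof.
have [/andP[/eqP <- _] _ _] := E_primitive.
by apply: span_combination => w /codomP[i ->]; exists i.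
Qed.

Lemma E_neq0 i : E i != 0.
Proof.
have [/andP[_ fE] _ _] := E_primitive.
exact: free_not0 fE (codom_f E i).
Qed.

Lemma BM_tr M : M \in BM -> M^T = M.
Proof.
case/BM_combination_Adj=> a ->; rewrite linear_sum; apply: eq_bigr => i _.
rewrite linearZ; congr (_ *: _); apply/matrixP=> s t.
by rewrite !mxE dist_sym.
Qed.

Lemma BM_conj M : M \in BM -> cmx M \in BM.
Proof.
case/BM_combination_Adj=> a ->.
have -> : cmx (\sum_i a i *: Adj i) = \sum_i (a i)^* *: Adj i.
  apply/matrixP=> s t; rewrite mxE !summxE rmorph_sum; apply: eq_bigr => i _.
  by rewrite !mxE rmorphM rmorph_nat.
by apply: memv_suml => i _; rewrite memvZ // Adj_in_BM.
Qed.

Lemma BM_mulE M : M \in BM -> exists a : 'I_D.+1 -> C,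
  forall i, E i *m M = a i *: E i /\ M *m E i = a i *: E i.
Proof.
have [_ mulE _] := E_primitive.
case/BM_combination_E=> a ->; exists a => i.
rewrite mulmx_sumr mulmx_suml !(bigD1 (P := predT) i) //= !big1 => [|k ki|k ki].
- by rewrite -scalemxAr -scalemxAl mulE eqxx !addr0.
- by rewrite -scalemxAl mulE (negPf ki) scaler0.
- by rewrite -scalemxAr mulE eq_sym (negPf ki) scaler0.
Qed.

(** The product of $E_i$ and $\overline{E_i}$ is a multiple $a_iE_i$, nonzero by positivity of the
    trace form, and $a_i=1$ because $\overline{E_i}$ is idempotent. Conjugating
    $E_i\overline{E_i}=E_i$ then gives the claim, as the two commute. *)
Lemma E_conj i : cmx (E i) = E i.
Proof.
have [_ mulE _] := E_primitive.
have [a ha] := BM_mulE (BM_conj (E_in_BM i)); have [EF FE] := ha i.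
have FF : cmx (E i) *m cmx (E i) = cmx (E i) by rewrite -map_mxM mulE eqxx.
have nz : E i *m cmx (E i) != 0.
  apply: contra_neq (E_neq0 i) => h; apply: mxtrace_definite.
  by rewrite BM_tr ?BM_conj ?E_in_BM // h mxtrace0.
have a0 : a i != 0 by apply: contraNneq nz => h; rewrite EF h scale0r.
have a1 : a i = 1.
  have : a i *: (a i *: E i) = a i *: E i.
    by rewrite -{1}EF scalemxAl -EF -mulmxA FF.
  move/(scalerI a0)/eqP; rewrite -subr_eq0 -{2}[E i]scale1r -scalerBl.
  by rewrite scaler_eq0 (negPf (E_neq0 i)) orbF subr_eq0 => /eqP.
by have := congr1 (fun M => cmx M) EF; rewrite map_mxM cmxK FE a1 scale1r => <-.
Qed.

Lemma E_resolution : real_resolution E.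
Proof.
have [_ mulE sumE] := E_primitive.
by split=> // i; [apply/BM_tr/E_in_BM|apply: E_conj].
Qed.

Lemma Es_resolution : real_resolution Es.
Proof.
split=> [i j||i|i].
- rewrite mulmx_diag; apply/matrixP=> s t; rewrite !mxE -natrM mulnb.
  have [->|ij] := eqVneq i j; first by rewrite andbb !mxE.
  rewrite mxE; case: (_ =P _) => [->|_]; last by rewrite mul0rn.
  by rewrite -val_eqE /= in ij; rewrite (negPf ij) mul0rn.
- apply/matrixP=> s t; rewrite summxE !mxE.
  rewrite (bigD1 (Ordinal (distD x (enum_val s)))) //= big1 => [|h].
    by rewrite !mxE eqxx addr0.
  by rewrite -val_eqE /= !mxE eq_sym => /negPf->; rewrite mul0rn.
- exact: tr_diag_mx.
- by apply/matrixP=> s t; rewrite !mxE rmorphMn /= rmorph_nat.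
Qed.

(** Since $c_{k+1}\ne0$, the recurrence expresses $Y_{k+1}$ through $Y_1Y_k$ and earlier terms. It
    serves both the distance matrices and their duals, as the Krein parameters equal the
    intersection numbers. *)
Lemma recurrence_preserves (Y : nat -> 'M[C]_#|X|) (U : {vspace 'cV[C]_#|X|}) :
  Y 0 = 1%:M ->
  (forall j, (j <= D)%N -> Y 1 *m Y j = \sum_(h < D.+1) (p h 1 j)%:R *: Y h) ->
  preserves (Y 1) U -> forall k, (k <= D)%N -> preserves (Y k) U.
Proof.
move=> Y0 rec U1; elim/ltn_ind=> -[|k] IH kD; first by rewrite Y0 => v; rewrite mul1mx.
have c0 : (p k.+1 1 k)%:R != 0 :> C.
  by rewrite pnatr_eq0 (intersection_c_neq0 e_connected x e_dist_regular) ?e_diameter.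
move=> v vU; have := rec k (ltnW kD).
rewrite (bigD1 (Ordinal (kD : (k.+1 < D.+1)%N))) //= => /(congr1 (fun M => M *m v)).
rewrite mulmxDl -mulmxA -scalemxAl => /esym/(canRL (addrK _)) h.
rewrite -[Y k.+1 *m v]scale1r -(mulVf c0) -scalerA memvZ // h memvB //.
  by apply: U1; apply: IH => //; apply: ltnW.
rewrite mulmx_suml; apply: memv_suml => l lk; rewrite -scalemxAl.
(* A nonzero coefficient forces $l\le k+1$, and $l=k+1$ has been split off, so the induction
   hypothesis applies. *)
have [->|pl] := eqVneq (p l 1 k) 0%N; first by rewrite scale0r mem0v.
apply: memvZ; apply: IH => //; last by rewrite -ltnS ltn_ord.
have lD : (l <= diameter e)%N by rewrite e_diameter -ltnS ltn_ord.
have := intersection_triangle e_sym e_connected x e_dist_regular lD pl.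
by move: lk; rewrite -val_eqE /=; lia.
Qed.

Lemma Adj0 : Adj 0 = 1%:M.
Proof.
apply/matrixP=> s t; rewrite !mxE dist_eq0 //.
by rewrite (inj_eq enum_val_inj).
Qed.

Lemma Adj1_mul j : Adj 1 *m Adj j = \sum_(h < D.+1) (p h 1 j)%:R *: Adj h.
Proof.
apply/matrixP=> s t; rewrite mxE summxE.
rewrite (bigD1 (Ordinal (distD (enum_val s) (enum_val t)))) //= [X in _ = _ + X]big1 => [|h].
  rewrite !mxE eqxx addr0 mulr1 -e_dist_regular.
  under eq_bigr do rewrite !mxE -natrM mulnb.
  rewrite -natr_sum; congr (_%:R); rewrite -sum1dep_card [RHS]big_mkcond /=.
  by rewrite [RHS]big_enum_val.
by rewrite -val_eqE /= !mxE eq_sym => /negPf->; rewrite mulr0.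
Qed.

Lemma Es_mulEs M (i j : 'I_D.+1) s t : (Es i *m M *m Es j) s t =
  (dist e x (enum_val s) == i)%:R * M s t * (dist e x (enum_val t) == j)%:R.
Proof. by rewrite mul_mx_diag mul_diag_mx !mxE. Qed.

(** Adjacent vertices have distances to [x] differing by at most one, and each [E i] is a
    combination of distance matrices, which the recurrence generates from the first. *)
Lemma Adj_generator : tridiagonal_generator Es E.
Proof.
have D1 : (1 < D.+1)%N by [].
have [th hth] := BM_combination_E (Adj_in_BM (Ordinal D1)).
exists (Adj 1), th; split=> // [i j ij|U U1 i].
  apply/matrixP=> s t; rewrite Es_mulEs !mxE.
  case: eqP => [si|_]; last by rewrite !mul0r.
  case: eqP => [st|_]; last by rewrite mulr0 mul0r.
  case: eqP => [tj|_]; last by rewrite mulr0.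
  have h1 := dist_triangle e_connected x (enum_val s) (enum_val t).
  have h2 := dist_triangle e_connected x (enum_val t) (enum_val s).
  rewrite (dist_sym e_sym e_connected (enum_val t)) st si tj in h2.
  by rewrite st si tj in h1; lia.
have [a ->] := BM_combination_Adj (E_in_BM i); apply: preserves_combination => k.
apply: recurrence_preserves; rewrite ?Adj0 //; last by rewrite -ltnS ltn_ord.
by move=> j _; apply: Adj1_mul.
Qed.

(* For [M = E_h] this is Terwilliger's dual distance matrix $A^*_h$. *)
Definition dual_mx (M : 'M[C]_#|X|) : 'M[C]_#|X| :=
  diag_mx (#|X|%:R *: row (enum_rank x) M).

Lemma dual_mxZ (a : C) (M : 'M[C]_#|X|) : dual_mx (a *: M) = a *: dual_mx M.
Proof. by apply/matrixP=> s t; rewrite !mxE mulrCA mulrnAr. Qed.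

Lemma dual_mx_sum (a : 'I_D.+1 -> C) (M : 'I_D.+1 -> 'M[C]_#|X|) :
  dual_mx (\sum_i a i *: M i) = \sum_i a i *: dual_mx (M i).
Proof.
apply/matrixP=> s t; rewrite summxE !mxE summxE mulr_sumr -sumrMnl.
by apply: eq_bigr => i _; rewrite !mxE mulrCA mulrnAr.
Qed.

(** Entrywise products become matrix products, which turns the Krein relations into the recurrence
    of [recurrence_preserves]. *)
Lemma dual_mx_Hadamard (M N : 'M[C]_#|X|) :
  dual_mx (map2_mx *%R M N) = #|X|%:R^-1 *: (dual_mx M *m dual_mx N).
Proof.
apply/matrixP=> s t; rewrite /dual_mx mulmx_diag !mxE mulrnAr; congr (_ *+ _).
by rewrite -[in RHS]mulrA mulKf // mulrCA.
Qed.

Lemma dual_mx_Adj (i : 'I_D.+1) : dual_mx (Adj i) = #|X|%:R *: Es i.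
Proof.
by apply/matrixP=> s t; rewrite !mxE enum_rankK -mulrnAr.
Qed.

Let i1 : 'I_D.+1 := Ordinal (D_gt0 : (1 < D.+1)%N).

(** The Krein parameters $q^h_{0j}=\delta_{hj}$ make $|X|E_0$ an identity for the entrywise product
    on the Bose-Mesner algebra, which contains the all-ones matrix. *)
Lemma E0_const : E ord0 = const_mx #|X|%:R^-1.
Proof.
have hJ : const_mx 1 = \sum_(i < D.+1) 1 *: Adj i.
  apply/matrixP=> s t; rewrite summxE mxE.
  rewrite (bigD1 (Ordinal (distD (enum_val s) (enum_val t)))) //= big1 => [|h].
    by rewrite !mxE eqxx addr0 mulr1.
  by rewrite -val_eqE /= !mxE eq_sym => /negPf->; rewrite mulr0.
have : const_mx 1 \in BM by rewrite hJ; apply: memv_suml => i _; rewrite memvZ // Adj_in_BM.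
case/BM_combination_E=> c hc.
have -> : E ord0 = map2_mx *%R (E ord0) (const_mx 1).
  by apply/matrixP=> s t; rewrite !mxE mulr1.
have -> : const_mx #|X|%:R^-1 = #|X|%:R^-1 *: const_mx 1 :> 'M[C]_#|X|.
  by apply/matrixP=> s t; rewrite !mxE mulr1.
have K0 j : map2_mx *%R (E ord0) (E j) = #|X|%:R^-1 *: E j.
  rewrite E_krein (bigD1 j) //= big1 => [|h /negPf hj].
    by rewrite (intersection_0l e_connected x) ?eqxx ?scale1r ?addr0 // e_diameter -ltnS.
  by rewrite (intersection_0l e_connected x) ?val_eqE ?hj ?scale0r // e_diameter -ltnS.
rewrite hc scaler_sumr; apply/matrixP=> s t.
rewrite mxE !summxE mulr_sumr; apply: eq_bigr => j _.
have := congr1 (fun M : 'M[C]_#|X| => c j * M s t) (K0 j); rewrite !mxE => h.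
by rewrite mulrCA h mulrCA.
Qed.

Lemma dual_mx_E0 : dual_mx (E ord0) = 1%:M.
Proof.
rewrite E0_const -diag_const_mx; congr diag_mx; apply/rowP=> s.
by rewrite !mxE mulfV.
Qed.

(* $\|E_iA^*E_j\|^2 = \sum_{s,t} A^*_s (E_i \circ E_j)_{st} A^*_t$ is a multiple of the
   Krein parameter $q^1_{ij}$. *)
Lemma E_dual_E (i j : 'I_D.+1) : p 1 i j = 0%N -> E i *m dual_mx (E i1) *m E j = 0.
Proof.
move=> pij; have [_ mulE _] := E_primitive.
have trE k := BM_tr (E_in_BM k).
have symE k s t : E k s t = E k t s by rewrite -{1}trE mxE.
set d := dual_mx _; pose v := col (enum_rank x) (E i1).
have Ev h : h != i1 -> E h *m v = 0.
  by move=> /negPf hi; rewrite /v colE mulmxA mulE hi mul0mx.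
(* Only the term $h=1$ of the Krein expansion survives on [v], and its coefficient $q^1_{ij}$ is
   zero. *)
have Hv : map2_mx *%R (E i) (E j) *m v = 0.
  rewrite E_krein -scalemxAl mulmx_suml big1 ?scaler0 // => h _; rewrite -scalemxAl.
  have [->|/Ev->] := eqVneq h i1; last by rewrite scaler0.
  by rewrite pij scale0r.
(* The diagonal of [d] is $|X|$ times [v], so this entry is one of $|X|(E_i\circ E_j)v$. The squared
   norm is the trace of $E_i d E_j d$ with [d] diagonal, hence needs these entries only. *)
have dE s : (E i *m d *m E j) s s = 0.
  rewrite mul_mx_diag mxE.
  transitivity (#|X|%:R * (map2_mx *%R (E i) (E j) *m v) s 0); last first.
    by rewrite Hv mxE mulr0.
  rewrite mxE mulr_sumr; apply: eq_bigr => t _; rewrite !mxE.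
  by rewrite (symE j t) (symE i1 t); ring.
apply: mxtrace_definite.
have -> : cmx (E i *m d *m E j) = E i *m d *m E j.
  rewrite !map_mxM !E_conj; congr (_ *m _ *m _); apply/matrixP=> s t.
  by rewrite !mxE rmorphMn rmorphM rmorph_nat /= -[in RHS]E_conj mxE.
have dT : d^T = d by apply: tr_diag_mx.
rewrite !trmx_mul !trE dT !mulmxA -[_ *m E j *m E j]mulmxA mulE eqxx.
rewrite mxtrace_mulC !mulmxA mulE eqxx.
rewrite mul_mx_diag; apply: big1 => s _; rewrite mxE.
by rewrite dE mul0r.
Qed.

(** The triangle inequality for [p], read on Krein parameters, gives tridiagonality, and the
    recurrence generates all dual distance matrices, whose span contains every [Es i]. *)
Lemma dual_generator : tridiagonal_generator E Es.
Proof.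
have [a ha] := BM_combination_Adj (E_in_BM i1).
exists (dual_mx (E i1)), (fun i => a i * #|X|%:R); split=> [|i j ij|U U1 i].
- rewrite ha dual_mx_sum; apply: eq_bigr => i _.
  by rewrite dual_mx_Adj scalerA.
- apply: E_dual_E; apply/eqP/negPn/negP=> pn.
  have D1 : (1 <= diameter e)%N by rewrite e_diameter.
  have := intersection_triangle e_sym e_connected x e_dist_regular D1 pn.
  by move: ij; lia.
have [c hc] := BM_combination_E (Adj_in_BM i).
have -> : Es i = \sum_h (#|X|%:R^-1 * c h) *: dual_mx (E h).
  under eq_bigr do rewrite -scalerA.
  by rewrite -scaler_sumr -dual_mx_sum -hc dual_mx_Adj scalerA mulVf // scale1r.
apply: preserves_combination => k.
(* The recurrence is indexed by naturals; [inord] is faithful for the indices up to [D] that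
   occur. *)
pose Y h := dual_mx (E (inord h)).
have YE (h : 'I_D.+1) : Y h = dual_mx (E h) by rewrite /Y inord_val.
rewrite -YE; apply: recurrence_preserves; last by rewrite -ltnS ltn_ord.
- by rewrite -dual_mx_E0 -YE.
- move=> j jD; have := congr1 dual_mx (E_krein i1 (Ordinal (jD : (j < D.+1)%N))).
  rewrite dual_mx_Hadamard dual_mxZ dual_mx_sum -!YE.
  move/(scalerI (invr_neq0 card_neq0)) => ->.
  by apply: eq_bigr => h _; rewrite YE.
- by rewrite (YE i1).
Qed.

Lemma graph_split_system : split_system Es E.
Proof.
split; [exact: Es_resolution|exact: E_resolution|exact: Adj_generator|].
exact: dual_generator.
Qed.

End Scheme.

Local Open Scope complex_scope.

Theorem theorem9p3 (R : realType) (X : finType) (e : rel X) (D : nat)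
  (p : nat -> nat -> nat -> nat) (b beta q : R[i])
  (E : 'I_D.+1 -> 'M[R[i]]_#|X|) (x : X)
  (B Bs K Ks Phi Psi : 'M[R[i]]_#|X|)
  (e_simple : simple_graph e)
  (e_connected : connected_graph e)
  (e_dist_regular : distance_regular e p)
  (e_diameter : diameter e = D)
  (D_ge3 : (3 <= D)%N)
  (b_neq1 : b != 1)
  (e_classical : classical_parameters_alpha_eq_bm1 p D b beta)
  (q_sq : q ^+ 2 = b)
  (E_primitive : primitive_idempotents e E)
  (E_krein : Krein_parameters E (fun h i j => (p h i j)%:R)) :
  let Es : 'I_D.+1 -> 'M[R[i]]_#|X| := dual_idempotent R[i] e x (D := D) in
  let A : 'M[R[i]]_#|X| := \sum_(i < D.+1) q ^ (D%:Z - 2 * i%:Z) *: E i in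
  let As : 'M[R[i]]_#|X| := \sum_(i < D.+1) q ^ (D%:Z - 2 * i%:Z) *: Es i in
  acts_on_split Es E down up (fun i j => q ^ (i - j)) B ->
  acts_on_split Es E up down (fun i j => q ^ (j - i)) Bs ->
  acts_on_split Es E down down (fun i j => q ^ (i - j)) K ->
  acts_on_split Es E up up (fun i j => q ^ (i - j)) Ks ->
  acts_on_split Es E down down (fun i j => q ^ (i + j - D%:Z)) Phi ->
  acts_on_split Es E down up (fun i j => q ^ (i + j - D%:Z)) Psi ->
  let x01 := A *m Phi *m invmx Psi in
  let x12 := B *m invmx Phi in
  let x23 := As *m Phi *m Psi in
  let x30 := Bs *m invmx Phi in
  let x02 := K *m invmx Psi in
  let x20 := Psi *m invmx K in
  let x13 := Ks *m Psi in
  let x31 := invmx Psi *m invmx Ks in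
  [/\ x01^T = x01, x12^T = x30, x23^T = x23 & x30^T = x12] /\
  [/\ x02^T = x31, x20^T = x13, x13^T = x20 & x31^T = x02].
Proof.
have [e_sym _] := e_simple; have D_gt0 : (0 < D)%N by lia.
move=> Es A As; apply: split_transpose.
  exact: (graph_split_system x e_sym e_connected e_dist_regular e_diameter D_gt0
            E_primitive E_krein).
(* It remains to see that $q\ne0$: otherwise $b=0$ and $c_2=b(b^2-1)/(b-1)=0$, although vertices at
   distance two have a common neighbour. *)
have D1 : (1 < diameter e)%N by rewrite e_diameter; lia.
have := intersection_c_neq0 e_connected x e_dist_regular D1.
rewrite -(@pnatr_eq0 R[i]); apply: contra_neq => q0.
have [+ _] := e_classical 2 (leq_trans (isT : 2 <= 3)%N D_ge3).
rewrite /c_num /= => ->.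
have -> : (2%:Z - 1 = 1)%R by [].
by rewrite expr1z -q_sq q0 expr0n mul0r.
Qed.
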